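(* Let $\overline\rho,\overline\theta,\overline\mu,\overline\alpha,\overline\tau_1,\overline\tau_4>0$ be constants with $\overline\tau_4=\frac{\overline\theta}{2}\overline\tau_1$, and let $\overline u\in\mathbb{R}^3$. The linearized dispersive Navier--Stokes--Fourier system for $U=(\rho,u,\theta)^\top\in\mathbb{R}^5$, $u\in\mathbb{R}^3$, $x\in\mathbb{R}^3$, $$\rho_t+\overline u\cdot\nabla\rho+\overline\rho\,\nabla\cdot u=0,$$ $$u_t+(\overline u\cdot\nabla)u+\tfrac{\overline\theta}{\overline\rho}\nabla\rho+\nabla\theta=\tfrac{\overline\mu}{\overline\rho}\Delta u+\tfrac13\tfrac{\overline\mu}{\overline\rho}\nabla(\nabla\cdot u)+\tfrac{2}{3\overline\rho}\overline\tau_1\nabla\Delta\theta,$$ $$\theta_t+\overline u\cdot\nabla\theta+\tfrac23\overline\theta\,\nabla\cdot u=\tfrac23\tfrac{\overline\alpha}{\overline\rho}\Delta\theta+\tfrac{8}{9\overline\rho}\overline\tau_4\Delta(\nabla\cdot u),$$ is genuinely coupled and symbol symmetrizable.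
   Context: The system is the linearization around a constant state $(\overline\rho,\overline u,\overline\theta)$; overlined quantities are values of the transport coefficients at that state. The system has the form $U_t+\sum_{|\alpha|\le m}L^\alpha D^\alpha U=0$ with constant real $n\times n$ matrices. For $\xi\in\mathbb{R}^d\setminus\{0\}$, $\omega=\xi/|\xi|$, put $A(\xi)=\sum_{|\alpha|\text{ odd}}|\xi|^{|\alpha|-1}(-1)^{(|\alpha|-1)/2}\omega^\alpha L^\alpha$ and $B(\xi)=\sum_{|\alpha|\text{ even}}|\xi|^{|\alpha|}(-1)^{|\alpha|/2}\omega^\alpha L^\alpha$ (so $\widehat U_t+i|\xi|A\widehat U+B\widehat U=0$). Symbol symmetrizable: there is $S\in C^\infty(\mathbb{R}^d\setminus\{0\};\mathbb{R}^{n\times n})$ with $S(\xi)$ symmetric positive definite, $S(\xi)A(\xi)$ and $S(\xi)B(\xi)$ symmetric and $S(\xi)B(\xi)\ge0$ for all $\xi\neq0$. Genuinely coupled: for every $\xi\ne0$, $(\mu I_n+A(\xi))\psi\ne0$ for every $\mu\in\mathbb{R}$ and every $\psi\in\ker B(\xi)$, $\psi\ne0$. *)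

(* Defs.v *)
From HB Require Import structures.
From mathcomp Require Import all_boot all_order all_algebra.
From mathcomp Require Import all_classical all_reals all_analysis.
Set Implicit Arguments.
Unset Strict Implicit.
Unset Printing Implicit Defensive.
Import Order.TTheory GRing.Theory Num.Theory numFieldNormedType.Exports.
Local Open Scope classical_set_scope.
Local Open Scope ring_scope.

(** * Partial derivatives and smooth functions on R^d *)

Definition partial (R : realType) (d : nat) (k : 'I_d) (f : 'rV[R]_d -> R) :
    'rV[R]_d -> R :=
  fun x => 'D_(delta_mx 0 k) f x.

(* C^oo on an open set: all iterated partial derivatives exist and are
   continuous there. *)
Definition smooth_on (R : realType) (d : nat) (Om : set 'rV[R]_d)
    (f : 'rV[R]_d -> R) : Prop :=
  forall s : seq 'I_d, let g := foldr (@partial R d) f s in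
  forall x, Om x ->
    {for x, continuous g} /\ forall k, derivable g x (delta_mx 0 k).

Definition grad (R : realType) (d : nat) (f : 'rV[R]_d -> R) :
    'rV[R]_d -> 'rV[R]_d :=
  fun x => \row_k partial k f x.

Definition divergence (R : realType) (d : nat) (v : 'rV[R]_d -> 'rV[R]_d) :
    'rV[R]_d -> R :=
  fun x => \sum_k partial k (fun y => v y 0 k) x.

Definition laplacian (R : realType) (d : nat) (f : 'rV[R]_d -> R) :
    'rV[R]_d -> R :=
  fun x => \sum_k partial k (partial k f) x.

(* (a . nabla) f *)
Definition advect (R : realType) (d : nat) (a : 'rV[R]_d)
    (f : 'rV[R]_d -> R) : 'rV[R]_d -> R :=
  fun x => \sum_k a 0 k * partial k f x.

(** * Systems U_t + \sum_(|al| <= m) L^al D^al U = 0 *)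

(* This type also contains al with |al| > m; every sum below is restricted to
   |al| <= m, so the value of a coefficient family there is irrelevant. *)
Definition mindex (d m : nat) := {ffun 'I_d -> 'I_m.+1}.

Definition mdegree (d m : nat) (al : mindex d m) : nat :=
  (\sum_(k < d) (al k : nat))%N.

Definition mpartial (R : realType) (d m : nat) (al : mindex d m)
    (f : 'rV[R]_d -> R) : 'rV[R]_d -> R :=
  foldr (fun k g => iter (al k) (partial k) g) f (enum 'I_d).

Definition mmonom (R : realType) (d m : nat) (w : 'rV[R]_d)
    (al : mindex d m) : R :=
  \prod_(k < d) w 0 k ^+ al k.

(* Derivatives of a vector-valued unknown are taken entrywise. *)
Definition tderive (R : realType) (d n : nat)
    (U : R -> 'rV[R]_d -> 'cV[R]_n) (t : R) (x : 'rV[R]_d) : 'cV[R]_n :=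
  \col_i derive1 (fun s => U s x i 0) t.

Definition mderive (R : realType) (d m n : nat) (al : mindex d m)
    (U : R -> 'rV[R]_d -> 'cV[R]_n) (t : R) (x : 'rV[R]_d) : 'cV[R]_n :=
  \col_i mpartial al (fun y => U t y i 0) x.

Definition regular_field (R : realType) (d n : nat)
    (U : R -> 'rV[R]_d -> 'cV[R]_n) : Prop :=
  forall i : 'I_n,
    (forall t, smooth_on setT (fun x => U t x i 0)) /\
    (forall x t, derivable (fun s => U s x i 0) t 1).

(* [sys U t x] says that U satisfies the equations of the system at (t, x).
   As U_t enters with the identity matrix, L^al (|al| <= m) is determined by
   the system. *)
Definition has_form (R : realType) (d n m : nat)
    (sys : (R -> 'rV[R]_d -> 'cV[R]_n) -> R -> 'rV[R]_d -> Prop)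
    (L : mindex d m -> 'M[R]_n) : Prop :=
  forall U, regular_field U -> forall t x,
    sys U t x <->
    tderive U t x
      + \sum_(al : mindex d m | (mdegree al <= m)%N) L al *m mderive al U t x
    = 0.

(* Euclidean norm; the library norm `|xi| on row vectors is the sup norm. *)
Definition enorm (R : realType) (d : nat) (xi : 'rV[R]_d) : R :=
  Num.sqrt (\sum_k xi 0 k ^+ 2).

Definition symbolA (R : realType) (d n m : nat) (L : mindex d m -> 'M[R]_n)
    (xi : 'rV[R]_d) : 'M[R]_n :=
  let w := (enorm xi)^-1 *: xi in
  \sum_(al : mindex d m | (mdegree al <= m)%N && odd (mdegree al))
     (enorm xi ^+ (mdegree al - 1) * (-1) ^+ ((mdegree al - 1) %/ 2)
        * mmonom w al) *: L al.

Definition symbolB (R : realType) (d n m : nat) (L : mindex d m -> 'M[R]_n)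
    (xi : 'rV[R]_d) : 'M[R]_n :=
  let w := (enorm xi)^-1 *: xi in
  \sum_(al : mindex d m | (mdegree al <= m)%N && ~~ odd (mdegree al))
     (enorm xi ^+ mdegree al * (-1) ^+ (mdegree al %/ 2)
        * mmonom w al) *: L al.

Definition symmetric_mx (R : realType) (n : nat) (M : 'M[R]_n) : Prop :=
  M^T = M.

Definition posdef_mx (R : realType) (n : nat) (M : 'M[R]_n) : Prop :=
  forall v : 'cV[R]_n, v != 0 -> 0 < (v^T *m M *m v) 0 0.

Definition possemidef_mx (R : realType) (n : nat) (M : 'M[R]_n) : Prop :=
  forall v : 'cV[R]_n, 0 <= (v^T *m M *m v) 0 0.

Definition symbol_symmetrizable (R : realType) (d n m : nat)
    (L : mindex d m -> 'M[R]_n) : Prop :=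
  exists S : 'rV[R]_d -> 'M[R]_n,
    (forall i j, smooth_on [set xi | xi != 0] (fun xi => S xi i j)) /\
    forall xi, xi != 0 ->
      [/\ symmetric_mx (S xi) /\ posdef_mx (S xi),
          symmetric_mx (S xi *m symbolA L xi),
          symmetric_mx (S xi *m symbolB L xi) &
          possemidef_mx (S xi *m symbolB L xi)].

Definition genuinely_coupled (R : realType) (d n m : nat)
    (L : mindex d m -> 'M[R]_n) : Prop :=
  forall xi : 'rV[R]_d, xi != 0 ->
  forall (mu : R) (psi : 'cV[R]_n),
    symbolB L xi *m psi = 0 -> psi != 0 -> (mu%:M + symbolA L xi) *m psi != 0.

(** * The linearized dispersive Navier-Stokes-Fourier system *)

Definition dispersive_NSF (R : realType)
    (rhob : R) (ub : 'rV[R]_3) (thetab mub alphab tau1b tau4b : R)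
    (rho : R -> 'rV[R]_3 -> R) (u : R -> 'rV[R]_3 -> 'rV[R]_3)
    (theta : R -> 'rV[R]_3 -> R) (t : R) (x : 'rV[R]_3) : Prop :=
  [/\ derive1 (fun s => rho s x) t + advect ub (rho t) x
        + rhob * divergence (u t) x = 0,
      forall i : 'I_3,
        derive1 (fun s => u s x 0 i) t + advect ub (fun y => u t y 0 i) x
          + thetab / rhob * grad (rho t) x 0 i + grad (theta t) x 0 i
        = mub / rhob * laplacian (fun y => u t y 0 i) x
          + 1 / 3 * (mub / rhob) * grad (divergence (u t)) x 0 i
          + 2 / (3 * rhob) * tau1b * grad (laplacian (theta t)) x 0 i &
      derive1 (fun s => theta s x) t + advect ub (theta t) x
        + 2 / 3 * thetab * divergence (u t) x
      = 2 / 3 * (alphab / rhob) * laplacian (theta t) x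
        + 8 / (9 * rhob) * tau4b * laplacian (divergence (u t)) x].

(* The unknown U = (rho, u, theta)^T, with 5 = 1 + (3 + 1). *)
Definition i_rho : 'I_5 := lshift (3 + 1) (ord0 : 'I_1).
Definition i_u (k : 'I_3) : 'I_5 := rshift 1 (lshift 1 k).
Definition i_theta : 'I_5 := rshift 1 (rshift 3 (ord0 : 'I_1)).

Definition dispersive_NSF_system (R : realType)
    (rhob : R) (ub : 'rV[R]_3) (thetab mub alphab tau1b tau4b : R)
    (U : R -> 'rV[R]_3 -> 'cV[R]_5) : R -> 'rV[R]_3 -> Prop :=
  dispersive_NSF rhob ub thetab mub alphab tau1b tau4b
    (fun t x => U t x i_rho 0) (fun t x => \row_k U t x (i_u k) 0)
    (fun t x => U t x i_theta 0).

(* Main.v *)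
(* In Fourier variables, with w = xi / |xi| and q = 1 + 2 tau1 |xi|^2 / (3 rho),
   the symbol A is (u . w) I plus the couplings rho w (rho-u), (theta / rho) w
   (u-rho), q w (u-theta) and (2/3) theta q w (theta-u); the factor q is the same
   in the last two exactly because tau4 = theta tau1 / 2.  Hence the constant matrix
   diag (theta / rho^2, 1, 3 / (2 theta)) symmetrizes A, and it turns B into the
   nonnegative form of viscosity and heat conduction, whose kernel consists of
   the pure density perturbations; A never has one of these as an eigenvector. *)
Require Import Defs.
From HB Require Import structures.
From mathcomp Require Import all_boot all_order all_algebra.
From mathcomp Require Import all_classical all_reals all_analysis.
From mathcomp Require Import ring.
Import Order.TTheory GRing.Theory Num.Theory numFieldNormedType.Exports.
Local Open Scope ring_scope.

(** * Symmetry of mixed directional derivatives *)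

Lemma is_derive_line (R : realType) (V : normedModType R) (f : V -> R)
    (v x : V) (s : R) :
  derivable f (s *: v + x) v ->
  is_derive s 1 (fun h : R => f (h *: v + x)) ('D_v f (s *: v + x)).
Proof.
move=> df; rewrite /derivable in df.
have E : (fun h : R => h^-1 *: (((fun h : R => f (h *: v + x)) \o shift s)
             (h *: 1) - f (s *: v + x)))
  = (fun h : R => h^-1 *: ((f \o shift (s *: v + x)) (h *: v)
             - f (s *: v + x))).
  by apply/funext => h /=; rewrite /shift /= scalerDl -addrA scaler1.
by split; rewrite /derivable /derive E.
Qed.

Lemma mvt_line (R : realType) (V : normedModType R) (f : V -> R) (v x : V)
    (h : R) : 0 < h -> (forall y, derivable f y v) ->
  exists2 a, 0 < a < h & f (h *: v + x) - f x = 'D_v f (a *: v + x) * h.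
Proof.
move=> h0 df.
have dg (s : R) := is_derive_line _ _ f v x s (df _).
have [a] := @MVT R _ _ 0 h h0 (fun s _ => dg s)
  (@derivable_within_continuous _ _ _ _
    (fun s _ => @ex_derive _ _ _ _ _ _ _ (dg s))).
rewrite in_itv /= => ah; rewrite scale0r add0r subr0 => E.
by exists a.
Qed.

(** The mean value theorem is applied twice. First it is used along [u] on the increment of [f] in
    direction [v]. The [u]-derivative of that increment is an increment of ['D_u f] in direction
    [v], to which the theorem applies again. *)
Lemma second_difference (R : realType) (V : normedModType R) (f : V -> R)
    (u v x : V) (h : R) : 0 < h ->
  (forall y, derivable f y u) -> (forall y, derivable ('D_u f) y v) ->
  exists a b, [/\ 0 < a < h, 0 < b < h &
    f (h *: u + (h *: v + x)) - f (h *: u + x) - (f (h *: v + x) - f x)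
    = 'D_v ('D_u f) (a *: u + (b *: v + x)) * (h * h)].
Proof.
move=> h0 df ddf.
pose g y := f (h *: v + y) - f y.
have dg y : is_derive y u g ('D_u f (h *: v + y) - 'D_u f y).
  apply: is_deriveB; last exact: derivableP.
  have E : (fun t : R => t^-1 *: (((fun y => f (h *: v + y)) \o shift y)
             (t *: u) - f (h *: v + y)))
    = (fun t : R => t^-1 *: ((f \o shift (h *: v + y)) (t *: u)
             - f (h *: v + y))).
    by apply/funext => t /=; rewrite /shift /= addrCA.
  by split; rewrite /derivable /derive E //; exact: df.
have [a ah Ea] := mvt_line _ _ g u x h h0 (fun y => @ex_derive _ _ _ _ _ _ _ (dg y)).
have [b bh Eb] := mvt_line _ _ ('D_u f) v (a *: u + x) h h0 ddf.
exists a, b; split=> //.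
rewrite mulrA [a *: u + _]addrCA -Eb.
rewrite -(@derive_val _ _ _ _ _ _ _ (dg (a *: u + x))) -Ea /g.
by rewrite [h *: v + (_ + _)]addrCA opprD addrACA -opprD.
Qed.

(** Two points [y] and [z] are allowed because the two orders of differentiation yield different
    intermediate points. Continuity puts both [F y] and [G z] within [e / 2] of the values at
    [x]. *)
Lemma eq_of_common_values (R : realType) (V : normedModType R) (F G : V -> R)
    (x : V) :
  {for x, continuous F} -> {for x, continuous G} ->
  (forall r : R, 0 < r -> exists y z, [/\ ball x r y, ball x r z & F y = G z]) ->
  F x = G x.
Proof.
move=> cF cG FG; apply/eqP; rewrite -subr_eq0 -normr_le0.
apply/ler_addgt0Pr => e e0; rewrite add0r.
have e20 : 0 < e / 2 by rewrite divr_gt0.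
have /nbhs_ballP[r1 /= r10 b1] := cF _ (nbhsx_ballx (F x) _ e20).
have /nbhs_ballP[r2 /= r20 b2] := cG _ (nbhsx_ballx (G x) _ e20).
have [|y [z [xy xz E]]] := FG (Num.min r1 r2); first by rewrite lt_min r10.
have H1 : ball (F x) (e / 2) (F y).
  by apply/b1/(le_ball _ xy); rewrite ge_min lexx.
have H2 : ball (G x) (e / 2) (G z).
  by apply/b2/(le_ball _ xz); rewrite ge_min lexx orbT.
rewrite -ball_normE /= in H1; rewrite -ball_normE /= in H2.
rewrite (_ : F x - G x = (F x - F y) - (G x - G z)); last first.
  by rewrite E opprB subrKA.
by rewrite (le_trans (ler_normB _ _)) // [leRHS]splitr lerD // ltW.
Qed.

(* Both mixed derivatives are limits of the same second difference quotient. *)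
Lemma deriveC (R : realType) (V : normedModType R) (f : V -> R) (u v x : V) :
  (forall y, derivable f y u) -> (forall y, derivable f y v) ->
  (forall y, derivable ('D_u f) y v) -> (forall y, derivable ('D_v f) y u) ->
  {for x, continuous ('D_v ('D_u f))} -> {for x, continuous ('D_u ('D_v f))} ->
  'D_v ('D_u f) x = 'D_u ('D_v f) x.
Proof.
move=> du dv duv dvu cuv cvu; apply: eq_of_common_values cuv cvu _ => r r0.
(* The summand 1 keeps [M] positive when [u = v = 0] and makes [h * (|u| + |v|)] strictly smaller
   than [r]. *)
pose M := `|u| + `|v| + 1.
have M0 : 0 < M by rewrite ltr_wpDl ?addr_ge0.
pose h := r / M.
have h0 : 0 < h by rewrite divr_gt0.
have near a b : 0 < a < h -> 0 < b < h -> ball x r (a *: u + (b *: v + x)).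
  move=> /andP[a0 ah] /andP[b0 bh].
  rewrite -ball_normE /= distrC addrA addrK.
  apply: (le_lt_trans (ler_normD _ _)).
  rewrite !normrZ !gtr0_norm //.
  apply: (@le_lt_trans _ _ (h * (`|u| + `|v|))).
    by rewrite mulrDr lerD // ler_wpM2r // ltW.
  by rewrite /h mulrAC -mulrA -[ltRHS]mulr1 ltr_pM2l // ltr_pdivrMr // mul1r /M ltrDl.
have [a [b [ah bh E1]]] := second_difference _ _ f u v x h h0 du duv.
have [b' [a' [bh' ah' E2]]] := second_difference _ _ f v u x h h0 dv dvu.
exists (a *: u + (b *: v + x)), (b' *: v + (a' *: u + x)); split.
- exact: near.
- by rewrite (addrCA (b' *: v)); exact: near.
(* Multiplied by [h * h], both sides are the same second difference of [f], which is symmetric in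
   [u] and [v]. *)
- apply: (@mulIf _ (h * h)); first by rewrite mulf_neq0 // gt_eqF.
  apply: etrans (esym E1) (etrans _ E2).
  by rewrite (addrCA (h *: v)) opprD addrACA -opprD.
Qed.

(** * Iterated partial derivatives of smooth functions *)

Local Notation partials f s := (foldr (fun k => partial k) f s).

Section SmoothFunctions.
Variables (R : realType) (d : nat).
Implicit Types (f : 'rV[R]_d -> R) (s : seq 'I_d) (k : 'I_d).

Lemma smooth_partials f s : smooth_on setT f -> smooth_on setT (partials f s).
Proof. by move=> sf t /= x _; rewrite -foldr_cat; exact: sf. Qed.

Lemma smooth_derivable f : smooth_on setT f ->
  forall k x, derivable f x (delta_mx 0 k).
Proof. by move=> sf k x; have [] := sf [::] x I. Qed.

Lemma smooth_continuous f : smooth_on setT f -> continuous f.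
Proof. by move=> sf x; have [] := sf [::] x I. Qed.

Lemma smooth_partial f k : smooth_on setT f -> smooth_on setT (partial k f).
Proof. exact: (smooth_partials f [:: k]). Qed.

Lemma partialC f k l : smooth_on setT f ->
  partial k (partial l f) = partial l (partial k f).
Proof.
move=> sf; apply/funext => x.
apply: (@deriveC R 'rV[R]_d f (delta_mx 0 l) (delta_mx 0 k) x).
- exact: smooth_derivable.
- exact: smooth_derivable.
- exact/smooth_derivable/(smooth_partial f l).
- exact/smooth_derivable/(smooth_partial f k).
- exact: (smooth_continuous _ (smooth_partials f [:: k; l] sf)).
- exact: (smooth_continuous _ (smooth_partials f [:: l; k] sf)).
Qed.

Lemma perm_partials f s t : smooth_on setT f -> perm_eq s t ->
  partials f s = partials f t.
Proof.
move=> sf; elim: s t => [|k s IHs] t; first by rewrite perm_sym => /perm_nilP ->.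
move=> st; have kt : k \in t by rewrite -(perm_mem st) mem_head.
case/splitPr: kt st => t1 t2 st.
have {st}/IHs /= -> : perm_eq s (t1 ++ t2).
  by rewrite -(perm_cons k) (perm_trans st) // (perm_catCA t1 [:: k]).
(* The derivative in direction [k] is moved past the letters of [t1] one at a time. *)
elim: t1 => //= l t1 <-; apply: partialC; exact: smooth_partials.
Qed.

Lemma partial_sum n (f : 'I_n -> 'rV[R]_d -> R) k :
  (forall i, smooth_on setT (f i)) ->
  partial k (fun x => \sum_i f i x) = fun x => \sum_i partial k (f i) x.
Proof.
move=> sf; apply/funext => x; rewrite /partial -derive_sum.
  by congr (derive _ x _); apply/funext => y; rewrite fct_sumE.
by move=> i; exact: smooth_derivable.
Qed.

End SmoothFunctions.

(** * Words of indices as multi-indices, and systems given by words *)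

Section WordIndices.
Variables (R : realType) (d m : nat).
Implicit Types (s : seq 'I_d) (al : mindex d m).

(** [inord] returns the true letter count only if it is at most [m]; the bounds on [size s] below
    guarantee this. *)
Definition windex s : mindex d m := [ffun k => inord (count_mem k s)].

Lemma windexE s k : (size s <= m)%N -> windex s k = count_mem k s :> nat.
Proof.
by move=> sm; rewrite ffunE inordK // ltnS (leq_trans (count_size _ _)).
Qed.

Lemma mdegree_windex s : (size s <= m)%N -> mdegree (windex s) = size s.
Proof.
move=> sm; rewrite /mdegree (eq_bigr _ (fun k _ => windexE s k sm)).
elim: s {sm} => [|l s IHs] /=; first by rewrite big1.
rewrite big_split /= IHs (bigD1 l) //= eqxx big1 // => k.
by rewrite eq_sym => /negbTE ->.
Qed.

Lemma mmonom_windex (w : 'rV[R]_d) s : (size s <= m)%N ->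
  mmonom w (windex s) = \prod_(k <- s) w 0 k.
Proof.
move=> sm; rewrite /mmonom.
rewrite [LHS](eq_bigr (fun k => w 0 k ^+ count_mem k s)) => [|k _]; last first.
  by rewrite windexE.
elim: s {sm} => [|l s IHs] /=; first by rewrite big1 ?big_nil.
rewrite big_cons -IHs (bigD1 l) //= [in RHS](bigD1 l) //= eqxx exprS mulrA.
congr (_ * _); apply: eq_bigr => k.
by rewrite eq_sym => /negbTE ->.
Qed.

(** [mpartial] differentiates along the word with equal letters grouped in increasing order. That
    word is a permutation of [s], so smoothness makes the two derivatives equal. *)
Lemma mpartial_windex (f : 'rV[R]_d -> R) s : (size s <= m)%N ->
  smooth_on setT f -> mpartial (windex s) f = partials f s.
Proof.
move=> sm sf.
have -> : mpartial (windex s) f =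
    partials f (flatten [seq nseq (windex s k) k | k <- enum 'I_d]).
  rewrite /mpartial; elim: (enum _) => //= k e ->; rewrite foldr_cat.
  by elim: (nat_of_ord _) => //= n ->.
apply: perm_partials => //; apply/allP => k _ /=; apply/eqP.
rewrite count_flatten -map_comp sumnE big_map big_enum /= (bigD1 k) //=.
rewrite count_nseq /= eqxx mul1n windexE // big1 ?addn0 // => l.
by rewrite count_nseq /= => /negbTE ->.
Qed.

End WordIndices.

(* A system is given by a list of pairs (word, matrix), a word (k_1, ..., k_j)
   standing for d_(k_1) ... d_(k_j); words that differ by a permutation have the
   same multi-index, and their matrices add up. *)
Section WordSystems.
Variables (R : realType) (d n m : nat).
Variable ts : seq (seq 'I_d * 'M[R]_n).
Hypothesis ts_small : {in ts, forall p, (size p.1 <= m)%N}.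

Definition word_coef (al : mindex d m) : 'M[R]_n :=
  \sum_(p <- ts | windex d m p.1 == al) p.2.

(** After exchanging the sums, each word contributes at exactly one multi-index, whose degree is the
    length of the word. Additivity of [F] lets it pass through the sum defining [word_coef]. The
    generality in [F] and [P] covers both symbols and the differential operator itself. *)
Lemma sum_word_coef (V : nmodType) (P : pred nat)
    (F : mindex d m -> 'M[R]_n -> V) :
  (forall al, F al 0 = 0) -> (forall al, {morph F al : A B / A + B}) ->
  \sum_(al : mindex d m | P (mdegree al)) F al (word_coef al)
  = \sum_(p <- ts | P (size p.1)) F (windex d m p.1) p.2.
Proof.
move=> F0 FD.
under eq_bigr do rewrite /word_coef (big_morph _ (FD _) (F0 _)).
rewrite (exchange_big_dep predT) //= [RHS]big_mkcond /=.
apply: eq_big_seq => p /ts_small sp.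
have [Ps|Ps] := boolP (P (size p.1)).
  rewrite (big_pred1 (windex d m p.1)) // => al /=.
  rewrite [RHS]eq_sym; case: eqVneq => [<-|_]; last exact: andbF.
  by rewrite mdegree_windex // Ps.
rewrite big1 // => al /andP[+ /eqP E].
by rewrite -E mdegree_windex // (negbTE Ps).
Qed.

Lemma symbolA_word (xi : 'rV[R]_d) :
  let w := (enorm xi)^-1 *: xi in
  symbolA word_coef xi = \sum_(p <- ts | odd (size p.1))
    (enorm xi ^+ (size p.1 - 1) * (-1) ^+ ((size p.1 - 1) %/ 2)
     * \prod_(k <- p.1) w 0 k) *: p.2.
Proof.
move=> w; rewrite /symbolA.
rewrite (sum_word_coef _ (fun j => (j <= m)%N && odd j)
  (fun al A => (enorm xi ^+ (mdegree al - 1) * (-1) ^+ ((mdegree al - 1) %/ 2)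
                * mmonom w al) *: A)).
- rewrite big_seq_cond [RHS]big_seq_cond; apply: eq_big => [p|p].
    by case: (boolP (p \in ts)) => //= /ts_small ->.
  by move=> /andP[/ts_small sp _]; rewrite mdegree_windex // mmonom_windex.
- by move=> al; rewrite scaler0.
- by move=> al A B; rewrite scalerDr.
Qed.

Lemma symbolB_word (xi : 'rV[R]_d) :
  let w := (enorm xi)^-1 *: xi in
  symbolB word_coef xi = \sum_(p <- ts | ~~ odd (size p.1))
    (enorm xi ^+ (size p.1) * (-1) ^+ (size p.1 %/ 2)
     * \prod_(k <- p.1) w 0 k) *: p.2.
Proof.
move=> w; rewrite /symbolB.
rewrite (sum_word_coef _ (fun j => (j <= m)%N && ~~ odd j)
  (fun al A => (enorm xi ^+ mdegree al * (-1) ^+ (mdegree al %/ 2)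
                * mmonom w al) *: A)).
- rewrite big_seq_cond [RHS]big_seq_cond; apply: eq_big => [p|p].
    by case: (boolP (p \in ts)) => //= /ts_small ->.
  by move=> /andP[/ts_small sp _]; rewrite mdegree_windex // mmonom_windex.
- by move=> al; rewrite scaler0.
- by move=> al A B; rewrite scalerDr.
Qed.

Lemma sum_mderive_word (U : R -> 'rV[R]_d -> 'cV[R]_n) t x :
  regular_field U ->
  \sum_(al : mindex d m | (mdegree al <= m)%N) word_coef al *m mderive al U t x
  = \sum_(p <- ts)
      p.2 *m (\col_i partials (fun y => U t y i 0) p.1 x).
Proof.
move=> rU.
rewrite (sum_word_coef _ (fun j => (j <= m)%N) (fun al A => A *m mderive al U t x)).
- rewrite big_seq_cond [RHS]big_seq_cond; apply: eq_big => [p|p].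
    by case: (boolP (p \in ts)) => //= /ts_small ->.
  move=> /andP[/ts_small sp _]; congr (_ *m _); apply/colP => i.
  by rewrite !mxE mpartial_windex //; case: (rU i).
- by move=> al; rewrite mul0mx.
- by move=> al A B; rewrite mulmxDl.
Qed.

End WordSystems.

(** * Density, velocity and temperature blocks of the state space *)

Lemma forall_I5 (P : 'I_5 -> Prop) :
  P i_rho -> (forall k, P (i_u k)) -> P i_theta -> forall i, P i.
Proof.
move=> Pr Pu Pt i.
have [j ->|j ->] := @split_ordP 1 (3 + 1) i; first by rewrite ord1.
by have [k ->|k ->] := @split_ordP 3 1 j; [exact: Pu|rewrite ord1].
Qed.

Lemma sum_I5 (V : nmodType) (F : 'I_5 -> V) :
  \sum_i F i = F i_rho + (\sum_k F (i_u k) + F i_theta).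
Proof. by rewrite (@big_split_ord _ _ _ 1 (3 + 1)) big_ord1 big_split_ord big_ord1. Qed.

Section BlockMatrix.
Variable R : realType.

(** The two density-temperature entries are fixed at zero: no coefficient matrix of the system and
    neither symbol couples these unknowns directly. *)
Definition state_mx (a : R) (b c : 'I_3 -> R) (D : 'I_3 -> 'I_3 -> R)
    (e f : 'I_3 -> R) (g : R) : 'M[R]_5 :=
  block_mx (const_mx a : 'M[R]_1) (row_mx (\row_j b j) 0)
    (col_mx (\col_i c i) 0)
    (block_mx (\matrix_(i, j) D i j) (\col_i e i) (\row_j f j) (const_mx g))
    : 'M[R]_(1 + (3 + 1)).

Lemma state_mxE a b c D e f g (M := state_mx a b c D e f g) :
  (M i_rho i_rho = a) * (forall j, M i_rho (i_u j) = b j) *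
  (M i_rho i_theta = 0) *
  (forall i, M (i_u i) i_rho = c i) *
  (forall i j, M (i_u i) (i_u j) = D i j) *
  (forall i, M (i_u i) i_theta = e i) *
  (M i_theta i_rho = 0) * (forall j, M i_theta (i_u j) = f j) *
  (M i_theta i_theta = g).
Proof.
rewrite /M /state_mx /i_rho /i_u /i_theta.
by do !split; intros;
  rewrite ?(@block_mxEul _ 1 (3 + 1) 1 (3 + 1)) ?(@block_mxEur _ 1 (3 + 1) 1 (3 + 1))
    ?(@block_mxEdl _ 1 (3 + 1) 1 (3 + 1)) ?(@block_mxEdr _ 1 (3 + 1) 1 (3 + 1))
    ?(row_mxEl, row_mxEr, col_mxEu, col_mxEd)
    ?(block_mxEul, block_mxEur, block_mxEdl, block_mxEdr) mxE.
Qed.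

Lemma mul_state_mx a b c D e f g (v : 'cV[R]_5)
    (w := state_mx a b c D e f g *m v) :
  (w i_rho 0 = a * v i_rho 0 + \sum_j b j * v (i_u j) 0) *
  (forall i, w (i_u i) 0 = c i * v i_rho 0
     + (\sum_j D i j * v (i_u j) 0 + e i * v i_theta 0)) *
  (w i_theta 0 = \sum_j f j * v (i_u j) 0 + g * v i_theta 0).
Proof.
do !split; intros; rewrite /w mxE sum_I5 !state_mxE.
- by under eq_bigr do rewrite state_mxE; rewrite mul0r addr0.
- by under eq_bigr do rewrite state_mxE.
- by under eq_bigr do rewrite state_mxE; rewrite mul0r add0r.
Qed.

Lemma sum_delta (F : 'I_3 -> R) i : \sum_k F k * (i == k)%:R = F i.
Proof.
rewrite (bigD1 i) //= eqxx mulr1 big1 ?addr0 // => k.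
by rewrite eq_sym => /negbTE ->; rewrite mulr0.
Qed.

End BlockMatrix.

(** * Diagonal matrices, constant functions and normalized frequencies *)

Lemma posdef_diag (R : realType) n (s : 'rV[R]_n) :
  (forall i, 0 < s 0 i) -> posdef_mx (diag_mx s).
Proof.
move=> s0 v v0; rewrite mul_mx_diag mxE.
have [i vi] : exists i, v i 0 != 0.
  by have /matrix0Pn[i [j]] := v0; rewrite ord1; exists i.
rewrite (bigD1 i) //= !mxE ltr_pwDl //.
  by rewrite mulrAC -expr2 mulr_gt0 // exprn_even_gt0.
apply: sumr_ge0 => j _; rewrite !mxE mulrAC -expr2.
by rewrite mulr_ge0 ?sqr_ge0 // ltW.
Qed.

Lemma smooth_cst (R : realType) d Om (c : R) : smooth_on Om (fun _ : 'rV[R]_d => c).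
Proof.
move=> s /= x _.
have [c' ->] : exists c', foldr (@partial R d) (fun=> c) s = fun=> c'.
  elim: s => [|k s [c' /= ->]]; first by exists c.
  by exists 0; apply/funext => y; exact: derive_cst.
by split=> [|k]; [exact: cst_continuous|exact: derivable_cst].
Qed.

Lemma enorm_gt0 (R : realType) d (xi : 'rV[R]_d) : xi != 0 -> 0 < enorm xi.
Proof.
move=> /matrix0Pn[i [k]]; rewrite ord1 => xk; rewrite sqrtr_gt0 (bigD1 k) //=.
by rewrite ltr_pwDl ?exprn_even_gt0 // sumr_ge0 // => l _; exact: sqr_ge0.
Qed.

Lemma enorm_normalize (R : realType) d (xi : 'rV[R]_d) : xi != 0 ->
  \sum_k ((enorm xi)^-1 *: xi) 0 k ^+ 2 = 1.
Proof.
move=> xi0; under eq_bigr do rewrite mxE exprMn.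
rewrite -mulr_sumr exprVn -[X in _ * X]sqr_sqrtr.
  by rewrite mulVf // sqrf_eq0 gt_eqF // enorm_gt0.
by apply: sumr_ge0 => k _; exact: sqr_ge0.
Qed.

(** * Coefficient matrices of the Navier-Stokes-Fourier system *)

Section DispersiveNSF.
Variables (R : realType) (rhob thetab mub alphab tau1b tau4b : R).
Variable ub : 'rV[R]_3.
Hypotheses (rhob_gt0 : 0 < rhob) (thetab_gt0 : 0 < thetab) (mub_gt0 : 0 < mub).
Hypothesis alphab_gt0 : 0 < alphab.
Hypothesis tau4bE : tau4b = thetab / 2 * tau1b.

Definition nsf1 (k : 'I_3) : 'M[R]_5 :=
  state_mx R (ub 0 k) (fun j => rhob * (j == k)%:R)
    (fun i => thetab / rhob * (i == k)%:R)
    (fun i j => ub 0 k * (i == j)%:R)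
    (fun i => (i == k)%:R) (fun j => 2 / 3 * thetab * (j == k)%:R) (ub 0 k).

(** The minus sign comes from moving the viscous and heat terms to the left-hand side. The Laplacian
    sits on the words with [k = l]. The term $\partial_i \partial_l u_l$ of the gradient of the
    divergence is attached to the word $(i, l)$ only, so [nsf2 k l] and [nsf2 l k] may differ; they
    add up in the coefficient of their common multi-index. *)
Definition nsf2 (k l : 'I_3) : 'M[R]_5 :=
  state_mx R 0 (fun=> 0) (fun=> 0)
    (fun i j => - (mub / rhob) *
       ((i == j)%:R * (k == l)%:R + 1 / 3 * ((j == l)%:R * (i == k)%:R)))
    (fun=> 0) (fun=> 0) (- (2 / 3 * (alphab / rhob)) * (k == l)%:R).

(** Attached to the words $(k, l, l)$ for every [l], this matrix multiplies $\partial_k \Delta$,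
    hence does not depend on [l]. *)
Definition nsf3 (k : 'I_3) : 'M[R]_5 :=
  state_mx R 0 (fun=> 0) (fun=> 0) (fun _ _ => 0)
    (fun i => - (2 / (3 * rhob) * tau1b) * (i == k)%:R)
    (fun j => - (8 / (9 * rhob) * tau4b) * (j == k)%:R) 0.

Definition nsf_words : seq (seq 'I_3 * 'M[R]_5) :=
  [seq ([:: k], nsf1 k) | k <- enum 'I_3] ++
  [seq ([:: k; l], nsf2 k l) | k <- enum 'I_3, l <- enum 'I_3] ++
  [seq ([:: k; l; l], nsf3 k) | k <- enum 'I_3, l <- enum 'I_3].

Lemma nsf_words_small : {in nsf_words, forall p, (size p.1 <= 3)%N}.
Proof.
move=> p; rewrite !mem_cat => /or3P[/mapP[k _ ->]|/allpairsP[kl [_ _ ->]]|] //.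
by move=> /allpairsP[kl [_ _ ->]].
Qed.

Definition nsf_coef : mindex 3 3 -> 'M[R]_5 := word_coef R 3 5 3 nsf_words.

(** The filters [P 1], [P 2], [P 3] are constant in [k]: for a parity predicate they reduce to true
    or false and select whole orders of differentiation. *)
Lemma sum_nsf_words (V : nmodType) (P : pred nat) (F : seq 'I_3 -> 'M[R]_5 -> V) :
  \sum_(p <- nsf_words | P (size p.1)) F p.1 p.2 =
    \sum_(k | P 1) F [:: k] (nsf1 k)
    + (\sum_(k | P 2) \sum_l F [:: k; l] (nsf2 k l)
       + \sum_(k | P 3) \sum_l F [:: k; l; l] (nsf3 k)).
Proof.
rewrite !big_cat /= big_map big_enum_cond /= ; congr (_ + (_ + _)).
  rewrite big_mkcond big_allpairs_dep big_enum /= [RHS]big_mkcond /=.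
  by apply: eq_bigr => k _; rewrite big_enum /=; case: (P 2) => //; rewrite big1.
rewrite big_mkcond big_allpairs_dep big_enum /= [RHS]big_mkcond /=.
by apply: eq_bigr => k _; rewrite big_enum /=; case: (P 3) => //; rewrite big1.
Qed.

(** * The symbols A and B in closed form *)

Let q (r : R) := 1 + 2 / (3 * rhob) * tau1b * r ^+ 2.

(** Only orders one and three are odd. In order three the sum over [l] of $\omega_l^2$ is 1, and the
    factor $-|\xi|^2$ cancels the minus sign in [nsf3]; the result merges with the first-order
    couplings into [q]. *)
Lemma nsf_symbolA (xi : 'rV[R]_3) (w := (enorm xi)^-1 *: xi) (r := enorm xi)
    (vel := \sum_k w 0 k * ub 0 k) : xi != 0 ->
  symbolA nsf_coef xi =
    state_mx R vel (fun j => rhob * w 0 j) (fun i => thetab / rhob * w 0 i)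
      (fun i j => vel * (i == j)%:R) (fun i => q r * w 0 i)
      (fun j => 2 / 3 * thetab * q r * w 0 j) vel.
Proof.
move=> xi0; have w1 : \sum_k w 0 k ^+ 2 = 1 by exact: enorm_normalize.
rewrite (symbolA_word _ _ _ _ _ nsf_words_small) -/w -/r.
rewrite (sum_nsf_words _ odd (fun s A => (r ^+ (size s - 1)
  * (-1) ^+ ((size s - 1) %/ 2) * \prod_(k <- s) w 0 k) *: A)) /=.
rewrite [X in _ + (X + _)]big_pred0_eq add0r.
rewrite [X in _ + X](_ : _ = \sum_k (- r ^+ 2 * w 0 k) *: nsf3 k); last first.
  apply: eq_bigr => k _; rewrite -scaler_suml; congr (_ *: _).
  transitivity (- r ^+ 2 * w 0 k * \sum_l w 0 l ^+ 2); last first.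
    by rewrite w1 mulr1.
  rewrite mulr_sumr; apply: eq_bigr => l _.
  by rewrite !big_cons big_nil subn1 divnn expr1; ring.
rewrite [X in X + _](_ : _ = \sum_k w 0 k *: nsf1 k); last first.
  by apply: eq_bigr => k _; rewrite big_cons big_nil subnn div0n !expr0 !mul1r mulr1.
rewrite -big_split /=.
have addE c d (M N : 'M[R]_5) i j : (c *: M + d *: N) i j = c * M i j + d * N i j.
  by rewrite !mxE.
apply/matrixP; elim/forall_I5 => [|i|]; elim/forall_I5 => [|j|];
  rewrite summxE state_mxE.
all: under eq_bigr do rewrite addE !state_mxE ?mulr0 ?addr0.
- by [].
- rewrite -[RHS](sum_delta R (fun k => rhob * w 0 k)).
  by apply: eq_bigr => k _; ring.
- by rewrite big1.
- rewrite -[RHS](sum_delta R (fun k => thetab / rhob * w 0 k)).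
  by apply: eq_bigr => k _; ring.
- by rewrite mulr_suml; apply: eq_bigr => k _; rewrite mulrA.
- rewrite -[RHS](sum_delta R (fun k => q r * w 0 k)).
  by apply: eq_bigr => k _; rewrite /q; ring.
- by rewrite big1.
- rewrite -[RHS](sum_delta R (fun k => 2 / 3 * thetab * q r * w 0 k)).
  (* The relation between the coefficients gives $\frac89\tau_4 = \frac23\theta\cdot\frac23\tau_1$,
     so the same [q] appears here as in the velocity rows. *)
  by apply: eq_bigr => k _; rewrite /q tau4bE; field; rewrite gt_eqF.
- by [].
Qed.

(** Only order two is even, and its factor $-|\xi|^2$ makes the signs positive. The Laplacians
    reduce to $|\omega|^2 = 1$, while the gradient of the divergence leaves the rank-one matrix with
    entries $\omega_i\omega_j$. *)
Lemma nsf_symbolB (xi : 'rV[R]_3) (w := (enorm xi)^-1 *: xi) (r := enorm xi) :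
  xi != 0 ->
  symbolB nsf_coef xi =
    state_mx R 0 (fun=> 0) (fun=> 0)
      (fun i j => r ^+ 2 * (mub / rhob) *
         ((i == j)%:R + 1 / 3 * (w 0 i * w 0 j)))
      (fun=> 0) (fun=> 0) (r ^+ 2 * (2 / 3 * (alphab / rhob))).
Proof.
move=> xi0; have w1 : \sum_k w 0 k ^+ 2 = 1 by exact: enorm_normalize.
rewrite (symbolB_word _ _ _ _ _ nsf_words_small) -/w -/r.
rewrite (sum_nsf_words _ (fun n => ~~ odd n) (fun s A => (r ^+ (size s)
  * (-1) ^+ (size s %/ 2) * \prod_(k <- s) w 0 k) *: A)) /=.
rewrite [X in X + _]big_pred0_eq add0r [X in _ + X]big_pred0_eq addr0.
rewrite (eq_bigr (fun k => \sum_l (- r ^+ 2 * (w 0 k * w 0 l)) *: nsf2 k l));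
  last first.
  move=> k _; apply: eq_bigr => l _; congr (_ *: _).
  by rewrite !big_cons big_nil divnn expr1; ring.
apply/matrixP; elim/forall_I5 => [|i|]; elim/forall_I5 => [|j|];
  rewrite summxE state_mxE.
all: under eq_bigr do [rewrite summxE; under eq_bigr do rewrite mxE state_mxE ?mulr0].
all: try by rewrite big1 // => k _; rewrite big1.
- pose c := r ^+ 2 * (mub / rhob).
  transitivity (\sum_k (c * (i == j)%:R * w 0 k ^+ 2
                        + c / 3 * (w 0 k * w 0 j) * (i == k)%:R)).
    apply: eq_bigr => k _.
    transitivity (\sum_l (c * (i == j)%:R * (w 0 k * w 0 l) * (k == l)%:R
      + c / 3 * (w 0 k * w 0 l) * (i == k)%:R * (j == l)%:R)).
      by apply: eq_bigr => l _; rewrite /c; ring.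
    by rewrite big_split /= !sum_delta expr2.
  by rewrite big_split /= -mulr_sumr w1 sum_delta /c; ring.
- pose c := r ^+ 2 * (2 / 3 * (alphab / rhob)).
  transitivity (\sum_k c * w 0 k ^+ 2); last by rewrite -mulr_sumr w1 mulr1.
  apply: eq_bigr => k _; rewrite -[RHS](sum_delta R (fun l => c * (w 0 k * w 0 l))).
  by apply: eq_bigr => l _; rewrite /c; ring.
Qed.

(** * Symmetrizer, dissipation and genuine coupling *)

Definition nsf_weight (i : 'I_5) : R :=
  if i == i_rho then thetab / rhob ^+ 2
  else if i == i_theta then 3 / (2 * thetab) else 1.

Lemma nsf_weightE : (nsf_weight i_rho = thetab / rhob ^+ 2)
  * (forall k, nsf_weight (i_u k) = 1) * (nsf_weight i_theta = 3 / (2 * thetab)).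
Proof.
split; first split; rewrite /nsf_weight ?eqxx // => k.
by rewrite -!val_eqE; case: k => -[|[|[|]]].
Qed.

Lemma nsf_weight_gt0 i : 0 < nsf_weight i.
Proof.
by elim/forall_I5: i => [|k|]; rewrite nsf_weightE // divr_gt0 ?exprn_gt0 ?mulr_gt0.
Qed.

Definition nsf_symmetrizer : 'M[R]_5 := diag_mx (\row_i nsf_weight i).

Lemma nsf_symmetrizerM (M : 'M[R]_5) i j :
  (nsf_symmetrizer *m M) i j = nsf_weight i * M i j.
Proof. by rewrite mul_diag_mx !mxE. Qed.

(** With velocity weight 1, symmetry amounts to $s_\rho\,\rho = \theta/\rho$ and
    $s_\theta\cdot\frac23\theta q = q$, which is where the weights come from. The velocity block is
    a multiple of the identity. *)
Lemma symmetric_nsf_symbolA (xi : 'rV[R]_3) : xi != 0 ->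
  symmetric_mx (nsf_symmetrizer *m symbolA nsf_coef xi).
Proof.
move=> xi0; rewrite /symmetric_mx nsf_symbolA //.
apply/matrixP; elim/forall_I5 => [|i|]; elim/forall_I5 => [|j|];
  rewrite mxE !nsf_symmetrizerM !state_mxE ?nsf_weightE ?mulr0 //.
- by field; rewrite gt_eqF.
- by field; rewrite gt_eqF.
- by rewrite [i == j]eq_sym.
- by field; rewrite gt_eqF.
- by field; rewrite gt_eqF.
Qed.

Lemma symmetric_nsf_symbolB (xi : 'rV[R]_3) : xi != 0 ->
  symmetric_mx (nsf_symmetrizer *m symbolB nsf_coef xi).
Proof.
move=> xi0; rewrite /symmetric_mx nsf_symbolB //.
apply/matrixP; elim/forall_I5 => [|i|]; elim/forall_I5 => [|j|];
  rewrite mxE !nsf_symmetrizerM !state_mxE ?nsf_weightE ?mulr0 //.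
by rewrite [i == j]eq_sym [X in 1 / 3 * X]mulrC.
Qed.

Lemma nsf_symmetrizer_quad (M : 'M[R]_5) (v : 'cV[R]_5) :
  (v^T *m (nsf_symmetrizer *m M) *m v) 0 0 =
    \sum_i nsf_weight i * (v i 0 * (M *m v) i 0).
Proof.
rewrite -mulmxA -mulmxA mxE; apply: eq_bigr => i _.
by rewrite mul_diag_mx !mxE mulrCA.
Qed.

(** This explicit sum of squares yields both the semidefiniteness of the symmetrized B and the
    description of its kernel. The weight $3/(2\theta)$ turns $\frac23\alpha/\rho$ into
    $\alpha/(\theta\rho)$. *)
Lemma nsf_dissipation (xi : 'rV[R]_3) (v : 'cV[R]_5)
    (w := (enorm xi)^-1 *: xi) (r := enorm xi) : xi != 0 ->
  (v^T *m (nsf_symmetrizer *m symbolB nsf_coef xi) *m v) 0 0 =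
    r ^+ 2 * (mub / rhob * (\sum_k v (i_u k) 0 ^+ 2
                + 1 / 3 * (\sum_k w 0 k * v (i_u k) 0) ^+ 2)
              + alphab / (thetab * rhob) * v i_theta 0 ^+ 2).
Proof.
move=> xi0; rewrite nsf_symbolB // nsf_symmetrizer_quad sum_I5 !mul_state_mx.
rewrite -/w -/r !nsf_weightE mul0r add0r.
rewrite [X in _ * (_ * X)]big1 => [|j _]; last by rewrite mul0r.
rewrite [X in _ + (_ + _ * (_ * (X + _)))]big1 => [|j _]; last by rewrite mul0r.
rewrite !mulr0 !add0r mulrDr; congr (_ + _); last first.
  by field; rewrite !gt_eqF.
(* [W] is the velocity component along $\xi$; the rank-one part of the velocity block contributes
   its square. *)
pose x k := v (i_u k) 0; pose W := \sum_k w 0 k * x k; pose c := r ^+ 2 * (mub / rhob).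
transitivity (\sum_k (c * x k ^+ 2 + c / 3 * W * (w 0 k * x k))).
  apply: eq_bigr => k _; rewrite !mul_state_mx nsf_weightE !mul0r add0r addr0 mul1r.
  transitivity (x k * (\sum_j (c * x j * (k == j)%:R + c / 3 * w 0 k * (w 0 j * x j)))).
    by congr (_ * _); apply: eq_bigr => j _; rewrite /c /x; ring.
  by rewrite big_split /= sum_delta -mulr_sumr -/W; ring.
by rewrite big_split /= -!mulr_sumr -/W /c /x; ring.
Qed.

Lemma possemidef_nsf_symbolB (xi : 'rV[R]_3) : xi != 0 ->
  possemidef_mx (nsf_symmetrizer *m symbolB nsf_coef xi).
Proof.
move=> xi0 v; rewrite nsf_dissipation //.
have S : 0 <= \sum_k v (i_u k) 0 ^+ 2 by apply: sumr_ge0 => k _; exact: sqr_ge0.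
have c1 : 0 < mub / rhob by rewrite divr_gt0.
have c2 : 0 < alphab / (thetab * rhob) by rewrite divr_gt0 ?mulr_gt0.
apply: mulr_ge0 (sqr_ge0 _) (addr_ge0 (mulr_ge0 (ltW c1) _) _).
  by rewrite addr_ge0 // mulr_ge0 ?sqr_ge0 // divr_ge0.
by rewrite mulr_ge0 ?sqr_ge0 // ltW.
Qed.

Lemma nsf_symmetrizable : symbol_symmetrizable nsf_coef.
Proof.
exists (fun=> nsf_symmetrizer); split=> [i j|xi xi0]; first exact: smooth_cst.
split; [split| | |].
- exact: tr_diag_mx.
- by apply: posdef_diag => i; rewrite mxE nsf_weight_gt0.
- exact: symmetric_nsf_symbolA.
- exact: symmetric_nsf_symbolB.
- exact: possemidef_nsf_symbolB.
Qed.

(* The dissipation vanishes only on pure density perturbations, and A maps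
   these to a nonzero velocity component along xi. *)
Lemma nsf_genuinely_coupled : genuinely_coupled nsf_coef.
Proof.
move=> xi xi0 mu psi Bpsi; apply: contra_neq => Apsi.
pose w := (enorm xi)^-1 *: xi.
(* Since B annihilates [psi], the dissipation at [psi] is zero, so each of its nonnegative terms is
   zero. *)
have := nsf_dissipation xi psi xi0.
rewrite -!mulmxA Bpsi !mulmx0 mxE => /esym/eqP.
rewrite mulf_eq0 expf_eq0 /= (gt_eqF (enorm_gt0 _ _ _ xi0)) /=.
have S : 0 <= \sum_k psi (i_u k) 0 ^+ 2 by apply: sumr_ge0 => k _; exact: sqr_ge0.
have c1 : 0 < mub / rhob by rewrite divr_gt0.
have c2 : 0 < alphab / (thetab * rhob) by rewrite divr_gt0 ?mulr_gt0.
have W : 0 <= 1 / 3 * (\sum_k w 0 k * psi (i_u k) 0) ^+ 2.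
  by rewrite mulr_ge0 ?sqr_ge0 // divr_ge0.
rewrite paddr_eq0; last by rewrite mulr_ge0 ?sqr_ge0 // ltW.
  2: by rewrite mulr_ge0 ?addr_ge0 // ltW.
rewrite (mulf_eq0 (mub / rhob)) (gt_eqF c1) paddr_eq0 //.
rewrite (mulf_eq0 (alphab / _)) (gt_eqF c2) sqrf_eq0 /=.
move=> /andP[/andP[/eqP Su _] /eqP pt].
have pu k : psi (i_u k) 0 = 0.
  apply/eqP; rewrite -sqrf_eq0; apply/eqP.
  by apply: (psumr_eq0P _ Su) => // l _; exact: sqr_ge0.
have [k xk] : exists k, xi 0 k != 0.
  by have /matrix0Pn[i [k]] := xi0; rewrite ord1; exists k.
(* In this row velocity and temperature have dropped out, and with them [mu]; what remains is
   $(\theta/\rho)\,\omega_k\,\psi_\rho = 0$ with $\omega_k \ne 0$. *)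
have /(congr1 (fun M : 'cV[R]_5 => M (i_u k) 0)) := Apsi.
rewrite mulmxDl mul_scalar_mx nsf_symbolA // mxE mul_state_mx !mxE pu pt.
rewrite big1 => [|j _]; last by rewrite pu mulr0.
rewrite !mulr0 !addr0 !add0r => /eqP; rewrite !mulf_eq0 !invr_eq0.
rewrite (gt_eqF thetab_gt0) (gt_eqF rhob_gt0) (gt_eqF (enorm_gt0 _ _ _ xi0)).
rewrite (negbTE xk) /= => /eqP pr.
by apply/colP; elim/forall_I5 => [|j|]; rewrite mxE.
Qed.

(** * Agreement of the coefficient family with the differential equations *)

Definition nsf_operator (d1 : 'I_5 -> 'I_3 -> R)
    (d2 d3 : 'I_5 -> 'I_3 -> 'I_3 -> R) : 'cV[R]_5 :=
  \sum_k nsf1 k *m (\col_i d1 i k)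
  + (\sum_k \sum_l nsf2 k l *m (\col_i d2 i k l)
     + \sum_k \sum_l nsf3 k *m (\col_i d3 i k l)).

(** The arrays stand for the derivatives of orders one to three at one point, which leaves pure
    linear algebra. They are arbitrary, so indices on the right keep the order they have in the
    words. *)
Lemma nsf_operatorE d1 d2 d3 (W := nsf_operator d1 d2 d3) :
  (W i_rho 0 = \sum_k ub 0 k * d1 i_rho k + rhob * \sum_k d1 (i_u k) k) *
  (forall i, W (i_u i) 0 =
     \sum_k ub 0 k * d1 (i_u i) k + thetab / rhob * d1 i_rho i + d1 i_theta i
     - (mub / rhob * \sum_k d2 (i_u i) k k
        + 1 / 3 * (mub / rhob) * \sum_k d2 (i_u k) i k
        + 2 / (3 * rhob) * tau1b * \sum_l d3 i_theta i l)) *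
  (W i_theta 0 =
     \sum_k ub 0 k * d1 i_theta k + 2 / 3 * thetab * \sum_k d1 (i_u k) k
     - (2 / 3 * (alphab / rhob) * \sum_k d2 i_theta k k
        + 8 / (9 * rhob) * tau4b * \sum_k \sum_l d3 (i_u k) k l)).
Proof.
have sumd (F : 'I_3 -> R) i : \sum_k F k * (k == i)%:R = F i.
  by under eq_bigr do rewrite eq_sym; exact: sum_delta.
have WE i : W i 0 = \sum_k (nsf1 k *m (\col_i d1 i k)) i 0
    + (\sum_k \sum_l (nsf2 k l *m (\col_i d2 i k l)) i 0
       + \sum_k \sum_l (nsf3 k *m (\col_i d3 i k l)) i 0).
  have addE (A B C : 'cV[R]_5) : (A + (B + C)) i 0 = A i 0 + (B i 0 + C i 0).
    by rewrite !mxE.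
  rewrite /W /nsf_operator addE !summxE; congr (_ + (_ + _));
    by apply: eq_bigr => k _; rewrite summxE.
split; first split; [|move=> i|]; rewrite WE.
- rewrite [X in _ + (X + _)]big1 => [|k _]; last first.
    rewrite big1 // => l _; rewrite mul_state_mx mul0r add0r.
    by rewrite big1 // => j _; rewrite mul0r.
  rewrite [X in _ + (_ + X)]big1 => [|k _]; last first.
    rewrite big1 // => l _; rewrite mul_state_mx mul0r add0r.
    by rewrite big1 // => j _; rewrite mul0r.
  rewrite !addr0 mulr_sumr -big_split /=; apply: eq_bigr => k _.
  rewrite mul_state_mx mxE; congr (_ + _).
  rewrite -[RHS](sumd (fun j => rhob * d1 (i_u j) k)).
  by apply: eq_bigr => j _; rewrite mxE; ring.
- have -> : \sum_k (nsf1 k *m (\col_i0 d1 i0 k)) (i_u i) 0 =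
      \sum_k ub 0 k * d1 (i_u i) k + thetab / rhob * d1 i_rho i + d1 i_theta i.
    rewrite -[X in _ + X](sum_delta _ (d1 i_theta)).
    rewrite -[X in _ + X + _](sum_delta _ (fun k => thetab / rhob * d1 i_rho k)).
    rewrite -!big_split; apply: eq_bigr => k _; rewrite mul_state_mx !mxE.
    rewrite (eq_bigr (fun j => ub 0 k * d1 (i_u j) k * (i == j)%:R)) => [|j _].
      by rewrite sum_delta /=; ring.
    by rewrite mxE; ring.
  have -> : \sum_k \sum_l (nsf2 k l *m (\col_i0 d2 i0 k l)) (i_u i) 0 =
      - (mub / rhob) * \sum_k d2 (i_u i) k k
      - 1 / 3 * (mub / rhob) * \sum_k d2 (i_u k) i k.
    (* The Kronecker factor [k == l] extracts the Laplacian; [i == k] together with [j == l]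
       extracts the gradient of the divergence. *)
    transitivity (\sum_k (- (mub / rhob) * d2 (i_u i) k k
        + (- (1 / 3 * (mub / rhob)) * \sum_l d2 (i_u l) k l) * (i == k)%:R)).
      apply: eq_bigr => k _.
      rewrite -(sum_delta _ (fun l => - (mub / rhob) * d2 (i_u i) k l)).
      rewrite mulr_sumr mulr_suml -big_split; apply: eq_bigr => l _ /=.
      rewrite mul_state_mx !mul0r add0r addr0.
      transitivity (\sum_j (- (mub / rhob) * (k == l)%:R * d2 (i_u j) k l * (i == j)%:R
        + (- (1 / 3 * (mub / rhob)) * d2 (i_u j) k l * (i == k)%:R) * (j == l)%:R)).
        by apply: eq_bigr => j _; rewrite mxE; ring.
      by rewrite big_split /= sum_delta sumd; ring.
    by rewrite big_split /= sum_delta -!mulr_sumr; ring.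
  have -> : \sum_k \sum_l (nsf3 k *m (\col_i0 d3 i0 k l)) (i_u i) 0 =
      - (2 / (3 * rhob) * tau1b) * \sum_l d3 i_theta i l.
    rewrite -[RHS](sum_delta _
      (fun k => - (2 / (3 * rhob) * tau1b) * \sum_l d3 i_theta k l)).
    apply: eq_bigr => k _; rewrite mulr_sumr mulr_suml; apply: eq_bigr => l _.
    rewrite mul_state_mx big1 => [|j _]; last by rewrite mul0r.
    by rewrite !mxE; ring.
  by ring.
- have -> : \sum_k (nsf1 k *m (\col_i0 d1 i0 k)) i_theta 0 =
      \sum_k ub 0 k * d1 i_theta k + 2 / 3 * thetab * \sum_k d1 (i_u k) k.
    rewrite mulr_sumr -big_split; apply: eq_bigr => k _ /=.
    rewrite mul_state_mx mxE addrC; congr (_ + _).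
    rewrite -[RHS](sumd (fun j => 2 / 3 * thetab * d1 (i_u j) k)).
    by apply: eq_bigr => j _; rewrite mxE; ring.
  have -> : \sum_k \sum_l (nsf2 k l *m (\col_i0 d2 i0 k l)) i_theta 0 =
      - (2 / 3 * (alphab / rhob)) * \sum_k d2 i_theta k k.
    rewrite mulr_sumr; apply: eq_bigr => k _.
    rewrite -[RHS](sum_delta _ (fun l => - (2 / 3 * (alphab / rhob)) * d2 i_theta k l)).
    apply: eq_bigr => l _.
    rewrite mul_state_mx big1 => [|j _]; last by rewrite mul0r.
    by rewrite !mxE; ring.
  have -> : \sum_k \sum_l (nsf3 k *m (\col_i0 d3 i0 k l)) i_theta 0 =
      - (8 / (9 * rhob) * tau4b) * \sum_k \sum_l d3 (i_u k) k l.
    rewrite mulr_sumr; apply: eq_bigr => k _.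
    rewrite mulr_sumr; apply: eq_bigr => l _.
    rewrite mul_state_mx mul0r addr0.
    rewrite -[RHS](sumd (fun j => - (8 / (9 * rhob) * tau4b) * d3 (i_u j) k l)).
    by apply: eq_bigr => j _; rewrite mxE; ring.
  by ring.
Qed.

Lemma nsf_has_form :
  has_form (dispersive_NSF_system rhob ub thetab mub alphab tau1b tau4b) nsf_coef.
Proof.
move=> U rU t x; rewrite (sum_mderive_word _ _ _ _ _ nsf_words_small) //.
pose f i y := U t y i 0.
have sf i : smooth_on setT (f i) by have [h _] := rU i; exact: h.
pose d1 i k := partial k (f i) x.
pose d2 i k l := partial k (partial l (f i)) x.
pose d3 i k l := partial k (partial l (partial l (f i))) x.
rewrite (sum_nsf_words _ predT
  (fun s A => A *m (\col_i foldr (fun k => partial k) (f i) s x))).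
(* With the filter [predT] all three orders are kept, and the sum is [nsf_operator] by
   conversion. *)
rewrite -[X in tderive U t x + X]/(nsf_operator d1 d2 d3).
have divE : divergence (fun y => \row_k U t y (i_u k) 0) =
    fun y => \sum_k partial k (f (i_u k)) y.
  apply/funext => y; apply: eq_bigr => k _; congr (partial k _ y).
  by apply/funext => z; rewrite mxE.
have gdivE i : grad (divergence (fun y => \row_k U t y (i_u k) 0)) x 0 i =
    \sum_k d2 (i_u k) i k.
  rewrite mxE divE partial_sum // => k; exact: smooth_partial.
have glapE i : grad (laplacian (f i_theta)) x 0 i = \sum_l d3 i_theta i l.
  rewrite mxE partial_sum // => k; exact/smooth_partial/smooth_partial.
(* This is the one term whose order of differentiation differs from its word: the Laplacian of the
   divergence has $\partial_k$ innermost, [d3] has it outermost. Smoothness allows the exchange. *)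
have lapdivE : laplacian (divergence (fun y => \row_k U t y (i_u k) 0)) x =
    \sum_k \sum_l d3 (i_u k) k l.
  rewrite exchange_big divE; apply: eq_bigr => l _.
  rewrite !partial_sum => [|k|k]; last 2 first.
  - exact/smooth_partial/smooth_partial.
  - exact: smooth_partial.
  apply: eq_bigr => k _.
  have llk : perm_eq [:: l; l; k] [:: k; l; l].
    by exact/permPl/(perm_catC [:: l; l] [:: k]).
  exact: (congr1 (@^~ x) (perm_partials _ _ (f (i_u k)) _ _ (sf _) llk)).
have rowE k s : (fun y => (\row_j U s y (i_u j) 0) 0 k) = (fun y => U s y (i_u k) 0).
  by apply/funext => y; rewrite mxE.
have rowtE k : (fun s => (\row_j U s x (i_u j) 0) 0 k) = (fun s => U s x (i_u k) 0).
  by apply/funext => y; rewrite mxE.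
have gradE i j : grad (fun y => U t y i 0) x 0 j = d1 i j by rewrite mxE.
set sys := dispersive_NSF_system _ _ _ _ _ _ _.
have opE i : (tderive U t x + nsf_operator d1 d2 d3) i 0 =
    derive1 (fun s => U s x i 0) t + nsf_operator d1 d2 d3 i 0 by rewrite !mxE.
have sysE : sys U t x <-> [/\
    (tderive U t x + nsf_operator d1 d2 d3) i_rho 0 = 0,
    forall i, (tderive U t x + nsf_operator d1 d2 d3) (i_u i) 0 = 0 &
    (tderive U t x + nsf_operator d1 d2 d3) i_theta 0 = 0].
  have and3_iff (A B C A' B' C' : Prop) : (A <-> A') -> (B <-> B') ->
      (C <-> C') -> [/\ A, B & C] <-> [/\ A', B' & C'].
    by move=> [? ?] [? ?] [? ?]; split=> -[? ? ?]; split; auto.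
  have forall_iff (P Q : 'I_3 -> Prop) : (forall i, P i <-> Q i) ->
      (forall i, P i) <-> (forall i, Q i).
    by move=> PQ; split=> H i; apply/PQ.
  have subE (a b : R) : a = b <-> a - b = 0.
    by split=> [->|/eqP]; [exact: subrr|rewrite subr_eq0 => /eqP].
  rewrite /sys /dispersive_NSF_system /dispersive_NSF.
  apply: and3_iff; last first.
  - apply: iff_trans (subE _ _) _.
    by rewrite opE nsf_operatorE lapdivE divE !addrA.
  - apply: forall_iff => i; apply: iff_trans (subE _ _) _.
    by rewrite opE nsf_operatorE rowtE rowE (gradE i_rho) (gradE i_theta) gdivE glapE !addrA.
  - by rewrite opE nsf_operatorE addrA divE.
rewrite sysE; split=> [[Hr Hu Ht]|->]; last by split=> *; rewrite mxE.
by apply/colP; elim/forall_I5 => [|i|]; rewrite [RHS]mxE.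
Qed.

End DispersiveNSF.

Theorem proposition5p18 (R : realType)
    (rhob thetab mub alphab tau1b tau4b : R) (ub : 'rV[R]_3)
    (rhob_gt0 : 0 < rhob) (thetab_gt0 : 0 < thetab) (mub_gt0 : 0 < mub)
    (alphab_gt0 : 0 < alphab) (tau1b_gt0 : 0 < tau1b) (tau4b_gt0 : 0 < tau4b)
    (tau4bE : tau4b = thetab / 2 * tau1b) :
  exists L : mindex 3 3 -> 'M[R]_5,
    [/\ has_form
          (dispersive_NSF_system rhob ub thetab mub alphab tau1b tau4b) L,
        genuinely_coupled L & symbol_symmetrizable L].
Proof.
exists (nsf_coef R rhob thetab mub alphab tau1b tau4b ub); split.
- exact: nsf_has_form.
- exact: nsf_genuinely_coupled.
- exact: nsf_symmetrizable.
Qed.
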